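(* Let $\mathcal{L}(x,y)=f(x)+\langle Kx,y\rangle-h^\ast(y)$ with $f=\sum_{i=1}^N f_i$ be as in the context, and assume: (A1) each $f_i$ ($1\le i\le N$) is $L_i$-smooth, with $L:=\sum_{i=1}^N L_i>0$; (A2) $h^\ast:\mathbb{R}^{d_2}\to(-\infty,\infty]$ is proper, closed and convex; (A3) the delays satisfy $\tau_k^i\in\{0,1,\dots,T\}$ for all $k$ and $i$, for a fixed nonnegative integer $T$; (B1) for each $i$ there is $\delta_i\in\mathbb{R}$ (not required to be nonnegative) such that $f_i(y)\ge f_i(x)+\langle\nabla f_i(x),y-x\rangle+\frac{\delta_i}{2}\|y-x\|^2$ for all $x,y\in\mathbb{R}^{d_1}$, and $\delta:=\sum_{i=1}^N\delta_i>0$; (B2) $h^\ast$ is $\gamma$-strongly convex with $\gamma>0$. Assume also that $\mathcal{L}$ has a unique saddle point $(\hat x,\hat y)$. Then for all sufficiently small step sizes $\sigma,\tau>0$ (i.e. there exist $\bar\sigma,\bar\tau>0$ such that the following holds for all $0<\sigma\le\bar\sigma$, $0<\tau\le\bar\tau$) and every $\theta$ with $$\left(\min\{3\delta\sigma/2,\,2\gamma\tau\}+1\right)^{-1}\le\theta\le 1,$$ the sequence $\{(x_k,y_k)\}_{k\ge0}$ generated by the PD-PIAG iteration with $\bar y=y_k+\theta(y_k-y_{k-1})$ at iteration $k$, i.e. $$g_k=\sum_{i=1}^N\nabla f_i(x_{k-\tau_k^i}),\quad x_{k+1}=x_k-\sigma g_k-\sigma K^T\big(y_k+\theta(y_k-y_{k-1})\big),\quad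 y_{k+1}=\mathrm{Prox}_{\tau h^\ast}(y_k+\tau Kx_{k+1}),$$ converges linearly to $(\hat x,\hat y)$ with rate $O(\omega^{k/2})$, that is, there is a constant $C$ with $\|x_k-\hat x\|+\|y_k-\hat y\|\le C\omega^{k/2}$ for all $k\ge 0$, where $$\omega:=\frac{1+\theta\sigma\|K\|}{\sigma\|K\|+1+\min\{3\delta\sigma/2,\,2\gamma\tau\}}.$$
   Context: Setting: $f_1,\dots,f_N:\mathbb{R}^{d_1}\to\mathbb{R}$ are smooth (differentiable) convex functions, $f=\sum_{i=1}^N f_i$, $K\in\mathbb{R}^{d_2\times d_1}$ is a matrix, $h^\ast$ is a convex, possibly nonsmooth function on $\mathbb{R}^{d_2}$ (in the application, the conjugate of a convex function $h$), and $\mathcal{L}(x,y):=f(x)+\langle Kx,y\rangle-h^\ast(y)$. $\|\cdot\|$ is the Euclidean norm for vectors and the induced operator norm for $K$. $f_i$ is $L_i$-smooth if $|f_i(y)-f_i(x)-\langle\nabla f_i(x),y-x\rangle|\le\frac{L_i}{2}\|y-x\|^2$ for all $x,y$. $h^\ast$ is $\gamma$-strongly convex if $h^\ast(y)\ge h^\ast(x)+\langle v,y-x\rangle+\frac{\gamma}{2}\|y-x\|^2$ for all $x,y$ and all $v\in\partial h^\ast(x)$, where $\partial h^\ast$ is the convex subdifferential. A point $(\hat x,\hat y)$ is a saddle point of $\mathcal{L}$ if $\mathcal{L}(\hat x,y)\le\mathcal{L}(\hat x,\hat y)\le\mathcal{L}(x,\hat y)$ for all $(x,y)\in\mathbb{R}^{d_1}\times\mathbb{R}^{d_2}$.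 Proximal operator: $\mathrm{Prox}_G(z):=\arg\min_u\{G(u)+\frac12\|u-z\|^2\}$. Delays $\tau_k^i$ ($k\ge 0$, $1\le i\le N$) are integers (not to be confused with the step size $\tau$). The initial point $(x_0,y_0)\in\mathbb{R}^{d_1}\times\mathbb{R}^{d_2}$ is arbitrary, and by convention $x_j=x_0$ and $y_j=y_0$ for $j<0$. *)

(* Defs.v *)
From HB Require Import structures.
From mathcomp Require Import all_boot all_order all_algebra.
From mathcomp Require Import all_classical all_reals all_analysis.

Set Implicit Arguments.
Unset Strict Implicit.
Unset Printing Implicit Defensive.

Import Order.TTheory GRing.Theory Num.Theory.
Import numFieldNormedType.Exports.

Local Open Scope classical_set_scope.
Local Open Scope ring_scope.

Section Defs.
Variable R : realType.

(* The library norm `|u| on matrices is the sup norm, hence the Euclidean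
   structure below.  Topology and differentiability on 'cV[R]_n are the
   library's, which do not depend on the choice of norm. *)
Definition dot n (u v : 'cV[R]_n) : R := \sum_i u i 0 * v i 0.

Definition enorm n (u : 'cV[R]_n) : R := Num.sqrt (dot u u).

Definition opnorm m n (K : 'M[R]_(m, n)) : R :=
  sup [set enorm (K *m u) | u in [set u : 'cV[R]_n | enorm u <= 1]].

(* Vector of partial derivatives; meaningful where f is differentiable. *)
Definition grad n (f : 'cV[R]_n -> R) (x : 'cV[R]_n) : 'cV[R]_n :=
  \col_j 'D_(delta_mx j 0) f x.

Definition smooth_with n (L : R) (f : 'cV[R]_n -> R) : Prop :=
  forall x y,
    `|f y - f x - dot (grad f x) (y - x)| <= L / 2 * enorm (y - x) ^+ 2.

Definition proper_fun n (h : 'cV[R]_n -> \bar R) : Prop :=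
  (forall y, h y != -oo%E) /\ (exists y, h y != +oo%E).

Definition epigraph n (h : 'cV[R]_n -> \bar R) : set ('cV[R]_n * R) :=
  [set p | (h p.1 <= p.2%:E)%E].

Definition closed_fun n (h : 'cV[R]_n -> \bar R) : Prop :=
  closed (epigraph h).

(* Intended for h never equal to -oo, so that the right-hand side has no
   (+oo) + (-oo); for t = 0 or 1 it relies on the convention 0 * +oo = 0. *)
Definition convex_efun n (h : 'cV[R]_n -> \bar R) : Prop :=
  forall (x y : 'cV[R]_n) (t : R), 0 <= t -> t <= 1 ->
    (h (t *: x + (1 - t) *: y)%R <= t%:E * h x + (1 - t)%:E * h y)%E.

(* For proper h this is empty outside the domain of h. *)
Definition subdiff n (h : 'cV[R]_n -> \bar R) (x : 'cV[R]_n) : set 'cV[R]_n :=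
  [set v | forall y, (h x + (dot v (y - x))%:E <= h y)%E].

Definition strongly_convex n (gamma : R) (h : 'cV[R]_n -> \bar R) : Prop :=
  forall x y v, subdiff h x v ->
    (h x + (dot v (y - x) + gamma / 2 * enorm (y - x) ^+ 2)%:E <= h y)%E.

(* The set of minimizers; a singleton when G is proper, closed and convex. *)
Definition prox n (G : 'cV[R]_n -> \bar R) (z : 'cV[R]_n) : set 'cV[R]_n :=
  [set u | forall w, (G u + (2^-1 * enorm (u - z) ^+ 2)%:E <=
                      G w + (2^-1 * enorm (w - z) ^+ 2)%:E)%E].

(* Takes the value -oo where h = +oo. *)
Definition lagrangian d1 d2 (f : 'cV[R]_d1 -> R) (K : 'M[R]_(d2, d1))
    (h : 'cV[R]_d2 -> \bar R) (x : 'cV[R]_d1) (y : 'cV[R]_d2) : \bar R :=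
  ((f x + dot (K *m x) y)%:E - h y)%E.

Definition saddle_point d1 d2 (Lag : 'cV[R]_d1 -> 'cV[R]_d2 -> \bar R)
    (xh : 'cV[R]_d1) (yh : 'cV[R]_d2) : Prop :=
  forall x y, (Lag xh y <= Lag xh yh)%E /\ (Lag xh yh <= Lag x yh)%E.

(* The truncated subtractions (k - delay k i)%N and k.-1 implement the
   conventions x_j = x_0 and y_j = y_0 for j < 0. *)
Definition pd_piag d1 d2 N (f : 'I_N -> 'cV[R]_d1 -> R) (K : 'M[R]_(d2, d1))
    (h : 'cV[R]_d2 -> \bar R) (delay : nat -> 'I_N -> nat)
    (sigma tau theta : R) (x : nat -> 'cV[R]_d1) (y : nat -> 'cV[R]_d2)
    : Prop :=
  forall k : nat,
    let g := \sum_(i < N) grad (f i) (x (k - delay k i)%N) in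
    let ybar := y k + theta *: (y k - y k.-1) in
    x k.+1 = x k - sigma *: g - sigma *: (K^T *m ybar) /\
    prox (fun u => (tau%:E * h u)%E) (y k + tau *: (K *m x k.+1)) (y k.+1).

End Defs.

(* Main.v *)
Require Import Defs.
From HB Require Import structures.
From mathcomp Require Import all_boot all_order all_algebra.
From mathcomp Require Import all_classical all_reals all_analysis.
From mathcomp Require Import zify ring lra.

Import Order.TTheory GRing.Theory Num.Theory.
Import numFieldNormedType.Exports.

Local Open Scope classical_set_scope.
Local Open Scope ring_scope.

(** The iteration is a primal-dual scheme, and the proof is a one-step
    contraction of a Lyapunov function.  Write e_k = x_k - xhat,
    w_k = y_k - yhat, s_k = x_{k+1} - x_k, d_k = y_k - y_{k-1} and
    kappa = |K|.

    Dual step ([dual_descent]).  The prox inclusion and the saddle condition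
    give subgradients of h at y_{k+1} and at yhat; strong convexity used at both
    ends makes the subdifferential gamma-strongly monotone, which yields the
    factor 1 + 2 gamma tau in front of |w_{k+1}|^2.

    Primal step ([primal_descent]).  The descent inequality between the stale
    point z_i = x_{k - delay} and x_{k+1}, and the lower curvature bound between
    z_i and xhat and between xhat and x_{k+1}, bound
      <grad f_i(z_i) - grad f_i(xhat), e_{k+1}>
    from below by delta_i/2 (|e_{k+1}|^2 + |z_i - xhat|^2), up to a multiple of
    |x_{k+1} - z_i|^2.  Replacing |z_i - xhat|^2 by |e_{k+1}|^2 costs a Young
    inequality, whose parameter is tuned so that a quarter of the curvature
    delta is lost: this is the origin of 3 delta sigma / 2.  The staleness
    |x_{k+1} - z_i|^2 is bounded by the last T + 1 squared increments |s_j|^2.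

    Dividing by sigma and tau and adding, the coupling terms combine into
    2 <K e_{k+1}, d_{k+1} - theta d_k>.  With B_k = <K e_k, d_k>, the function
      V_k = |e_k|^2/sigma + |w_k|^2/tau - 2 theta B_k + kappa |d_k|^2 + M_k
    satisfies V_{k+1} <= omega V_k ([lyapunov_contraction]).  Here M_k is a sum
    of the squared increments |s_j|^2, j < k, whose weights at least double with
    each step towards the present ([memory_step]); as 1/omega <= 1 + mu <= 2,
    it absorbs the staleness for every small sigma.  The value of omega is
    exactly the one for which the surplus (1 + mu - 1/omega) |e_{k+1}|^2/sigma
    pays for the excess (theta/omega - 1) kappa |e_{k+1}|^2 left over in the
    coupling term ([rate_identity]); all remaining errors are multiples of
    |s_k|^2 and |d_{k+1}|^2, absorbed by |s_k|^2/sigma and |d_{k+1}|^2/tau.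
    Since V_k dominates |e_k|^2 + |w_k|^2/tau, geometric decay of V gives the
    rate. *)

Set Implicit Arguments.
Unset Strict Implicit.

(** * Euclidean inequalities *)

Section Euclidean.
Context {R : realType}.

Lemma dotC n (u v : 'cV[R]_n) : dot u v = dot v u.
Proof. by apply: eq_bigr => i _; rewrite mulrC. Qed.

Lemma dot0l n (v : 'cV[R]_n) : dot 0 v = 0.
Proof. by apply: big1 => i _; rewrite mxE mul0r. Qed.

Lemma dotDl n (u v w : 'cV[R]_n) : dot (u + v) w = dot u w + dot v w.
Proof. by rewrite -big_split; apply: eq_bigr => i _; rewrite mxE mulrDl. Qed.

Lemma dotZl n a (u v : 'cV[R]_n) : dot (a *: u) v = a * dot u v.
Proof. by rewrite mulr_sumr; apply: eq_bigr => i _; rewrite mxE mulrA. Qed.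

Lemma dotNl n (u v : 'cV[R]_n) : dot (- u) v = - dot u v.
Proof. by rewrite -scaleN1r dotZl mulN1r. Qed.

Lemma dotDr n (u v w : 'cV[R]_n) : dot u (v + w) = dot u v + dot u w.
Proof. by rewrite dotC dotDl !(dotC u). Qed.

Lemma dotZr n a (u v : 'cV[R]_n) : dot u (a *: v) = a * dot u v.
Proof. by rewrite dotC dotZl dotC. Qed.

Lemma dotNr n (u v : 'cV[R]_n) : dot u (- v) = - dot u v.
Proof. by rewrite dotC dotNl dotC. Qed.

Definition dotE := (dotDl, dotDr, dotNl, dotNr, dotZl, dotZr).

Lemma dot_suml n N (F : 'I_N -> 'cV[R]_n) v :
  dot (\sum_i F i) v = \sum_i dot (F i) v.
Proof.
rewrite /dot exchange_big; apply: eq_bigr => j _.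
by rewrite summxE mulr_suml.
Qed.

Lemma dot_mulmx m n (K : 'M[R]_(m, n)) u v :
  dot (K^T *m u) v = dot (K *m v) u.
Proof.
rewrite /dot; under eq_bigr => i _ do rewrite mxE mulr_suml.
under [RHS]eq_bigr => i _ do rewrite mxE mulr_suml.
rewrite exchange_big; apply: eq_bigr => i _; apply: eq_bigr => j _.
by rewrite mxE mulrAC.
Qed.

Lemma dot_ge0 n (u : 'cV[R]_n) : 0 <= dot u u.
Proof. by apply: sumr_ge0 => i _; rewrite -expr2 sqr_ge0. Qed.

Lemma dot_eq0 n (u : 'cV[R]_n) : dot u u = 0 -> u = 0.
Proof.
move=> uu0; apply/colP => i; rewrite mxE; apply/eqP.
rewrite -[_ == 0]orbb -mulf_eq0; apply/eqP.
by apply: (psumr_eq0P _ uu0) => // j _; rewrite -expr2 sqr_ge0.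
Qed.

Lemma enorm_ge0 n (u : 'cV[R]_n) : 0 <= enorm u.
Proof. exact: sqrtr_ge0. Qed.

Lemma enorm_sqr n (u : 'cV[R]_n) : enorm u ^+ 2 = dot u u.
Proof. by rewrite sqr_sqrtr // dot_ge0. Qed.

Lemma dot_young n (eta : R) (u v : 'cV[R]_n) : 0 < eta ->
  `|2 * dot u v| <= eta * dot u u + eta^-1 * dot v v.
Proof.
move=> eta_gt0.
have square c : eta^-1 * dot (eta *: u + c *: v) (eta *: u + c *: v) =
    eta * dot u u + c * (2 * dot u v) + eta^-1 * (c * c * dot v v).
  by rewrite !dotE (dotC v u); field; rewrite gt_eqF.
have square_ge0 c : 0 <= eta^-1 * dot (eta *: u + c *: v) (eta *: u + c *: v).
  by rewrite mulr_ge0 ?dot_ge0 // invr_ge0 ltW.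
have := square_ge0 1; have := square_ge0 (-1); rewrite !square ler_norml.
by move=> h1 h2; apply/andP; split; lra.
Qed.

Lemma dot_cauchy_schwarz n (u v : 'cV[R]_n) :
  `|dot u v| <= enorm u * enorm v.
Proof.
have [v0|v_neq0] := eqVneq (dot v v) 0.
  rewrite (dot_eq0 v0) dotC dot0l.
  by rewrite normr0 mulr_ge0 // enorm_ge0.
have v_gt0 : 0 < dot v v by rewrite lt_neqAle eq_sym v_neq0 dot_ge0.
rewrite -(@ler_pXn2r _ 2) ?nnegrE ?mulr_ge0 ?enorm_ge0 //.
rewrite exprMn !enorm_sqr real_normK ?num_real //.
(* Up to the factor |v|^2, the part of u orthogonal to v. *)
have := dot_ge0 (dot v v *: u - dot u v *: v).
rewrite !dotE (dotC v u) => h.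
by rewrite -(ler_pM2l v_gt0); nra.
Qed.

(** Cauchy-Schwarz on each row of K bounds |K u| by the Frobenius norm of K,
    so that the supremum defining [opnorm] is a genuine one. *)
Lemma opnorm_has_sup m n (K : 'M[R]_(m, n)) :
  has_sup [set enorm (K *m u) | u in [set u : 'cV[R]_n | enorm u <= 1]].
Proof.
split.
  by exists (enorm (K *m 0)), 0 => //=; rewrite /enorm dot0l sqrtr0.
exists (Num.sqrt (\sum_i dot (row i K)^T (row i K)^T)) => _ [u /= u1 <-].
rewrite ler_wsqrtr //; apply: ler_sum => i _.
have -> : (K *m u) i 0 = dot (row i K)^T u.
  by rewrite mxE; apply: eq_bigr => j _; rewrite !mxE.
rewrite -expr2 -[X in X <= _]real_normK ?num_real // -enorm_sqr.
rewrite ler_pXn2r ?nnegrE ?enorm_ge0 //.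
by rewrite (le_trans (dot_cauchy_schwarz _ _)) // ler_piMr ?enorm_ge0.
Qed.

Lemma opnorm_ge0 m n (K : 'M[R]_(m, n)) : 0 <= opnorm K.
Proof.
have [[_ [u u1 _]] ub] := opnorm_has_sup K.
apply: le_trans (enorm_ge0 (K *m u)) _.
by apply: ub_le_sup => //; exists u.
Qed.

Lemma enormZ n a (u : 'cV[R]_n) : 0 <= a -> enorm (a *: u) = a * enorm u.
Proof.
move=> a0; rewrite /enorm dotZl dotZr mulrA sqrtrM ?mulr_ge0 //.
by rewrite -expr2 sqrtr_sqr ger0_norm.
Qed.

Lemma enorm_eq0 n (u : 'cV[R]_n) : enorm u = 0 -> u = 0.
Proof.
by move=> u0; apply: dot_eq0; rewrite -enorm_sqr u0 expr0n.
Qed.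

Lemma enorm_mulmx m n (K : 'M[R]_(m, n)) u :
  enorm (K *m u) <= opnorm K * enorm u.
Proof.
have [/enorm_eq0 ->|u_neq0] := eqVneq (enorm u) 0.
  by rewrite mulmx0 /enorm !dot0l sqrtr0 mulr0.
have u_gt0 : 0 < enorm u by rewrite lt_neqAle eq_sym u_neq0 enorm_ge0.
rewrite -ler_pdivrMr // mulrC -enormZ ?invr_ge0 ?enorm_ge0 // scalemxAr.
apply: ub_le_sup; first by case: (opnorm_has_sup K).
by exists ((enorm u)^-1 *: u) => //=; rewrite enormZ ?mulVf ?invr_ge0 ?enorm_ge0.
Qed.

(** This is how every coupling term is controlled. *)
Lemma dot_mulmx_young m n (K : 'M[R]_(m, n)) u v :
  `|2 * dot (K *m u) v| <= opnorm K * (dot u u + dot v v).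
Proof.
rewrite normrM ger0_norm //.
have h1 := dot_cauchy_schwarz (K *m u) v.
have h2 := ler_wpM2r (enorm_ge0 v) (enorm_mulmx K u).
have h3 := mulr_ge0 (opnorm_ge0 K) (sqr_ge0 (enorm u - enorm v)).
by rewrite -!enorm_sqr; nra.
Qed.

(** The triangle inequality in squared form, with |a + b|^2 <= 2 (|a|^2 + |b|^2)
    at each step; any constant depending on the length alone is good enough. *)
Lemma dot_path_le n (x : nat -> 'cV[R]_n) m p :
  dot (x (m + p)%N - x m) (x (m + p)%N - x m) <=
  2 ^+ p * \sum_(m <= j < m + p) dot (x j.+1 - x j) (x j.+1 - x j).
Proof.
elim: p => [|p IH]; first by rewrite addn0 subrr dot0l big_geq // mulr0.
rewrite addnS big_nat_recr ?leq_addr //=.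
set s := x (m + p).+1 - x (m + p)%N; set q := x (m + p)%N - x m in IH *.
have -> : x (m + p).+1 - x m = s + q by rewrite /s /q addrA subrK.
clearbody s q; have h := dot_ge0 (s - q); rewrite !dotE (dotC q s) in h *.
have ps : (1 : R) <= 2 ^+ p by rewrite exprn_ege1 // ler1n.
have := mulr_ge0 (ltW (lt_le_trans ltr01 ps)) (dot_ge0 s).
have := ler_wpM2r (dot_ge0 s) ps.
rewrite exprS; lra.
Qed.

(** Truncated subtraction makes the window [k - T, k] stop at index 0, in
    accordance with x_j = x_0 for j < 0. *)
Lemma dot_delay_le n (x : nat -> 'cV[R]_n) k t T : (t <= T)%N ->
  dot (x k.+1 - x (k - t)%N) (x k.+1 - x (k - t)%N) <=
  2 ^+ T.+1 *
    \sum_(0 <= j < k.+1 | (k - j <= T)%N) dot (x j.+1 - x j) (x j.+1 - x j).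
Proof.
move=> tT; have := dot_path_le x (k - t)%N (k.+1 - (k - t))%N.
rewrite subnKC; last by rewrite ltnW // ltnS leq_subr.
move/le_trans; apply.
apply: ler_pM; first by rewrite exprn_ge0.
- by apply: sumr_ge0 => i _; exact: dot_ge0.
- by rewrite ler_weXn2l ?ler1n //; lia.
rewrite (@big_nat_widenl _ _ _ (k - t)%N 0) // big_mkcond [leRHS]big_mkcond /=.
rewrite !big_nat; apply: ler_sum => j /andP[_ jk].
case: ifP => h1; case: ifP => h2 //; last exact: dot_ge0.
by exfalso; move: h1 h2; lia.
Qed.

End Euclidean.

(** * Optimality conditions and subgradients *)

Section Optimality.
Context {R : realType}.

(** Dividing by t and letting t tend to 0: the variational argument behind
    both optimality conditions below. *)
Lemma first_order_ge0 (a b : R) :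
  (forall t, 0 < t -> t <= 1 -> 0 <= t * a + t ^+ 2 * b) -> 0 <= a.
Proof.
move=> ab; rewrite leNgt; apply/negP => a0.
have ba : 0 < `|b| - a by have := normr_ge0 b; lra.
(* At this step size t |b| < - a, so t a + t^2 b would be negative. *)
have t0 : 0 < - a / (`|b| - a) by rewrite divr_gt0 // oppr_gt0.
have t1 : - a / (`|b| - a) <= 1.
  by rewrite ler_pdivrMr //; have := normr_ge0 b; lra.
have {ab} := ab _ t0 t1; set t := _ / _ in t0 t1 *.
have tb : t * (`|b| - a) = - a by rewrite /t mulfVK // gt_eqF.
have := ler_wpM2l (ltW t0) (ler_norm b) => h.
rewrite expr2 -mulrA -mulrDr => /(mulr_ge0 (ltW t0)).
rewrite leNgt => /negP; apply.
rewrite mulrA -expr2 pmulr_rlt0 ?exprn_gt0 //; nra.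
Qed.

Lemma subdiff_fin_num n (h : 'cV[R]_n -> \bar R) x v :
  proper_fun h -> subdiff h x v -> h x \is a fin_num.
Proof.
move=> [hN [w hw]] /(_ w); rewrite fin_numE hN /=; apply: contraTN => /eqP ->.
by rewrite addye // leye_eq.
Qed.

(** Sum of the two strong convexity inequalities obtained by exchanging the
    points. *)
Lemma subdiff_strong_monotone n gamma (h : 'cV[R]_n -> \bar R) x y u v :
  proper_fun h -> strongly_convex gamma h -> subdiff h x u -> subdiff h y v ->
  gamma * dot (y - x) (y - x) <= dot (v - u) (y - x).
Proof.
move=> hp hs xu yv; move: (hs _ y _ xu) (hs _ x _ yv).
move: (subdiff_fin_num hp xu) (subdiff_fin_num hp yv).
case: (h x) => // a _; case: (h y) => // b _.
rewrite -!EFinD !lee_fin !enorm_sqr -(opprB y x); move: (y - x) => e.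
by rewrite !dotE; lra.
Qed.

(** Fermat's rule: compare the minimizer u with the points t v + (1 - t) u of
    the segment towards v, and keep the first order terms in t. *)
Lemma prox_subdiff n (h : 'cV[R]_n -> \bar R) tau z u :
  proper_fun h -> convex_efun h -> 0 < tau ->
  prox (fun w => tau%:E * h w)%E z u -> subdiff h u (tau^-1 *: (z - u)).
Proof.
move=> [hN [w0 hw0]] hc tau0 pu.
have [a ha] : exists a, h u = a%:E.
  move: (hN u) (pu w0) (hN w0) hw0.
  case: (h u) => [a _|_|//]; first by exists a.
  by case: (h w0) => // b; rewrite gt0_muley ?lte_fin // addye // leye_eq -EFinM.
move=> v; rewrite ha; move: (hN v); case hv: (h v) => [b|//|//] _;
  last exact: leey.
rewrite -EFinD lee_fin.
rewrite -(ler_pM2l tau0) mulrDr dotZl mulVKf ?gt_eqF // -subr_ge0.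
apply: (@first_order_ge0 _ (2^-1 * dot (v - u) (v - u))) => t t0 t1.
move: (pu (t *: v + (1 - t) *: u)) (hc v u t (ltW t0) t1).
move: (hN (t *: v + (1 - t) *: u)); rewrite ha hv.
case: (h _) => // c _; rewrite -!EFinM -!EFinD !lee_fin !enorm_sqr.
have -> : t *: v + (1 - t) *: u - z = t *: (v - u) - (z - u).
  by apply/colP => i; rewrite !mxE; ring.
rewrite -(opprB z u); move: (z - u) (v - u) => p e.
rewrite !dotE (dotC e p) => hu /(ler_wpM2l (ltW tau0)); nra.
Qed.

Lemma saddle_subdiff d1 d2 (f : 'cV[R]_d1 -> R) (K : 'M[R]_(d2, d1)) h x y :
  proper_fun h -> saddle_point (lagrangian f K h) x y ->
  subdiff h y (K *m x).
Proof.
move=> [hN [w hw]] sxy.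
have [b hb] : exists b, h y = b%:E.
  move: (hN y) (hN w) hw (sxy x w).1; rewrite /lagrangian.
  case: (h y) => [b|//|//]; first by exists b.
  by case: (h w) => // c _ _ _; rewrite leeNy_eq.
move=> v; move: (hN v) (sxy x v).1; rewrite /lagrangian hb.
case: (h v) => [c|//|//] _; last by rewrite leey.
by rewrite -!EFinB -!EFinD !lee_fin !dotE; lra.
Qed.

(** The variational inequality for the minimizer x of the Lagrangian at y.
    Stated as an inequality in every direction v, it follows from the quadratic
    upper bound on each f_i and is what the primal step uses. *)
Lemma saddle_gradient_ge0 d1 d2 N (f : 'I_N -> 'cV[R]_d1 -> R) L
    (K : 'M[R]_(d2, d1)) h x y v :
  proper_fun h -> (forall i, smooth_with (L i) (f i)) ->
  saddle_point (lagrangian (fun x => \sum_i f i x) K h) x y ->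
  0 <= \sum_i dot (grad (f i) x) v + dot (K *m v) y.
Proof.
move=> hp fL sxy.
have [b hb] : exists b, h y = b%:E.
  have := subdiff_fin_num hp (saddle_subdiff hp sxy).
  by case: (h y) => // b; exists b.
apply: (@first_order_ge0 _ (\sum_i (L i / 2 * dot v v))) => t t0 t1.
move: (sxy (x + t *: v) y).2; rewrite /lagrangian hb -!EFinB lee_fin.
have : \sum_i f i (x + t *: v) <=
    \sum_i (f i x + t * dot (grad (f i) x) v + t ^+ 2 * (L i / 2 * dot v v)).
  apply: ler_sum => i _; have := fL i x (x + t *: v).
  rewrite ler_norml enorm_sqr addrAC subrr add0r !dotE => /andP[_].
  by lra.
rewrite 2!big_split /= -!mulr_sumr mulmxDr -scalemxAr !dotE.
lra.
Qed.

(** Three inequalities are added: the upper bound from z to x, the lower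
    bounds from z to xh and from xh to x.  The term delta |z - xh|^2 is then
    compared with delta |x - xh|^2; [eta] is the Young parameter, and absolute
    values appear because delta may have either sign. *)
Lemma delayed_gradient_ge n (f : 'cV[R]_n -> R) L delta eta xh z x :
  smooth_with L f -> 0 < eta ->
  (forall x y,
     f x + dot (grad f x) (y - x) + delta / 2 * enorm (y - x) ^+ 2 <= f y) ->
  dot (grad f xh) (x - xh)
    + (delta - eta / 2 * `|delta|) * dot (x - xh) (x - xh)
    - (`|L| + (1 + eta^-1) * `|delta|) / 2 * dot (x - z) (x - z)
  <= dot (grad f z) (x - xh).
Proof.
move=> fL eta0 fd.
move: (fL z x) (fd z xh) (fd xh x); rewrite !enorm_sqr ler_norml => /andP[_].
have -> : xh - z = (x - z) - (x - xh) by rewrite opprB [RHS]addrC addrA subrK.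
move: (x - z) (x - xh) (f x) (f z) (f xh) (grad f z) (grad f xh) => {fL fd}.
move=> p e fx fz fh Gz Gh; rewrite !dotE (dotC e p) => h1 h2 h3.
have hY : - `|delta| * (eta * dot e e + eta^-1 * dot p p) <=
          - delta * (2 * dot p e).
  rewrite !mulNr lerN2 (le_trans (ler_norm _)) // normrM ler_wpM2l //.
  by rewrite dotC dot_young.
have hp : - `|delta| * dot p p <= delta * dot p p.
  by rewrite ler_wpM2r ?dot_ge0 // lerNl -normrN ler_norm.
have hL : L * dot p p <= `|L| * dot p p by rewrite ler_wpM2r ?dot_ge0 ?ler_norm.
nra.
Qed.

End Optimality.

(** * Descent inequalities and the Lyapunov contraction *)

Section Descent.
Context {R : realType}.

(** Total factor of the staleness terms in the primal step; the quotient is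
    the inverse of the Young parameter chosen in [aggregated_gradient_ge]. *)
Definition curvature_cost N (L delta : 'I_N -> R) : R :=
  \sum_i (`|L i| + (1 + 2 * (\sum_j `|delta j|) / \sum_j delta j) * `|delta i|).

Definition delay_cost N (L delta : 'I_N -> R) (T : nat) : R :=
  2 ^+ T.+1 * curvature_cost L delta.

Lemma curvature_cost_ge0 N (L delta : 'I_N -> R) :
  0 < \sum_i delta i -> 0 <= curvature_cost L delta.
Proof.
move=> d0; apply: sumr_ge0 => i _; rewrite addr_ge0 // mulr_ge0 //.
by rewrite addr_ge0 // divr_ge0 ?(ltW d0) // mulr_ge0 // sumr_ge0.
Qed.

Lemma delay_cost_ge0 N (L delta : 'I_N -> R) T :
  0 < \sum_i delta i -> 0 <= delay_cost L delta T.
Proof. by move=> d0; rewrite mulr_ge0 ?exprn_ge0 ?curvature_cost_ge0. Qed.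

(** Each function loses eta |delta_i| / 2 of its curvature; the choice
    eta = delta / (2 sum |delta_i|) makes the total loss delta / 4. *)
Lemma aggregated_gradient_ge n N (f : 'I_N -> 'cV[R]_n -> R) L delta xh
    (x : nat -> 'cV[R]_n) k T (d : 'I_N -> nat) :
  (forall i, smooth_with (L i) (f i)) ->
  (forall i x y, f i x + dot (grad (f i) x) (y - x)
     + delta i / 2 * enorm (y - x) ^+ 2 <= f i y) ->
  0 < \sum_i delta i -> (forall i, d i <= T)%N ->
  \sum_i dot (grad (f i) xh) (x k.+1 - xh)
    + 3 / 4 * (\sum_i delta i) * dot (x k.+1 - xh) (x k.+1 - xh)
    - 2^-1 * (delay_cost L delta T *
        \sum_(0 <= j < k.+1 | (k - j <= T)%N) dot (x j.+1 - x j) (x j.+1 - x j))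
  <= \sum_i dot (grad (f i) (x (k - d i)%N)) (x k.+1 - xh).
Proof.
move=> fL fd dp dT.
set D := \sum_i delta i in dp *; set A := \sum_i `|delta i|.
set S := \sum_(0 <= j < k.+1 | _) _; set E := dot (x k.+1 - xh) (x k.+1 - xh).
have DA : D <= A by apply: ler_sum => i _; apply: ler_norm.
have A0 : 0 < A := lt_le_trans dp DA.
pose eta := D / (2 * A).
have eta0 : 0 < eta by rewrite divr_gt0 // mulr_gt0.
have etaV : eta^-1 = 2 * A / D by rewrite /eta invf_div.
have etaA : eta * A = D / 2 by rewrite /eta; field; rewrite gt_eqF.
pose c i := `|L i| + (1 + eta^-1) * `|delta i|.
have c0 i : 0 <= c i.
  by rewrite addr_ge0 // mulr_ge0 // addr_ge0 // invr_ge0 ltW.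
have cE : \sum_i c i = curvature_cost L delta.
  by apply: eq_bigr => i _; rewrite /c etaV.
suff: \sum_i (dot (grad (f i) xh) (x k.+1 - xh)
      + (delta i - eta / 2 * `|delta i|) * E - c i * (2^-1 * (2 ^+ T.+1 * S)))
    <= \sum_i dot (grad (f i) (x (k - d i)%N)) (x k.+1 - xh).
  rewrite sumrB big_split /= -!mulr_suml sumrB -mulr_sumr cE /delay_cost -/D -/A.
  have -> : eta / 2 * A = eta * A / 2 by rewrite mulrAC.
  by rewrite etaA => /(le_trans _); apply; lra.
apply: ler_sum => i _.
apply: le_trans
  (delayed_gradient_ge xh (x (k - d i)%N) (x k.+1) (fL i) eta0 (fd i)).
rewrite lerD2l lerN2 -mulrA -/(c i) ler_wpM2l // ler_wpM2l ?invr_ge0 //.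
exact: dot_delay_le.
Qed.

(** Expand |e_k|^2 = |e_{k+1} - s_k|^2 and substitute the primal update in the
    cross term, then bound it by [aggregated_gradient_ge] and by optimality of
    xh in the direction e_{k+1}. *)
Lemma primal_descent d1 d2 N (f : 'I_N -> 'cV[R]_d1 -> R) L delta
    (K : 'M[R]_(d2, d1)) xh yh (x : nat -> 'cV[R]_d1) ybar sigma k T
    (d : 'I_N -> nat) :
  (forall i, smooth_with (L i) (f i)) ->
  (forall i x y, f i x + dot (grad (f i) x) (y - x)
     + delta i / 2 * enorm (y - x) ^+ 2 <= f i y) ->
  0 < \sum_i delta i -> (forall i, d i <= T)%N ->
  (forall v, 0 <= \sum_i dot (grad (f i) xh) v + dot (K *m v) yh) ->
  0 < sigma ->
  x k.+1 = x k - sigma *: (\sum_i grad (f i) (x (k - d i)%N))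
             - sigma *: (K^T *m ybar) ->
  (1 + 3 * (\sum_i delta i) * sigma / 2) * dot (x k.+1 - xh) (x k.+1 - xh)
    + dot (x k.+1 - x k) (x k.+1 - x k)
    - sigma * (delay_cost L delta T *
        \sum_(0 <= j < k.+1 | (k - j <= T)%N) dot (x j.+1 - x j) (x j.+1 - x j))
    + 2 * sigma * dot (K *m (x k.+1 - xh)) (ybar - yh)
  <= dot (x k - xh) (x k - xh).
Proof.
move=> fL fd dp dT opt s0 xk.
have := aggregated_gradient_ge xh x k fL fd dp dT.
have := opt (x k.+1 - xh); rewrite -!dot_suml.
set S := delay_cost _ _ _ * _; set g := \sum_i _ in xk *; set D := \sum_i delta i.
have -> : x k - xh = (x k.+1 - xh) - (x k.+1 - x k).
  by rewrite opprB [RHS]addrC addrA subrK.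
have : dot (x k.+1 - x k) (x k.+1 - xh) =
    - sigma * (dot g (x k.+1 - xh) + dot (K *m (x k.+1 - xh)) ybar).
  have -> : x k.+1 - x k = - (sigma *: g + sigma *: (K^T *m ybar)).
    by rewrite xk addrAC [X in X - _]addrAC subrr add0r opprD.
  by rewrite dotNl dotDl !dotZl dot_mulmx; ring.
move: (x k.+1 - xh) (x k.+1 - x k) => e s se opte ag.
rewrite !dotE (dotC e s) se.
have := ler_wpM2l (ltW s0) (lerD opte ag).
nra.
Qed.

(** Expand |w_k|^2 = |w_{k+1} - d_{k+1}|^2; strong monotonicity bounds the
    cross term. *)
Lemma dual_descent d1 d2 gamma (h : 'cV[R]_d2 -> \bar R)
    (K : 'M[R]_(d2, d1)) xh yh x y y' tau :
  proper_fun h -> convex_efun h -> strongly_convex gamma h -> 0 < tau ->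
  subdiff h yh (K *m xh) ->
  prox (fun u => tau%:E * h u)%E (y + tau *: (K *m x)) y' ->
  (1 + 2 * gamma * tau) * dot (y' - yh) (y' - yh) + dot (y' - y) (y' - y)
    - 2 * tau * dot (K *m (x - xh)) (y' - yh)
  <= dot (y - yh) (y - yh).
Proof.
move=> hp hc hs t0 oh /(prox_subdiff hp hc t0) py.
have := subdiff_strong_monotone hp hs oh py.
have -> : tau^-1 *: (y + tau *: (K *m x) - y') - K *m xh =
    - (tau^-1 *: (y' - y)) + K *m (x - xh).
  rewrite mulmxBr addrA; congr (_ - _); rewrite addrAC scalerDr scalerA.
  by rewrite mulVf ?gt_eqF // scale1r -scalerN opprB.
have -> : y - yh = (y' - yh) - (y' - y) by rewrite opprB [RHS]addrC addrA subrK.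
move: (y' - yh) (y' - y) (K *m (x - xh)) => w d p.
move=> /(ler_wpM2l (ltW t0)); rewrite !dotE (dotC w d) [X in _ <= X]mulrDr.
by rewrite mulrN mulVKf ?gt_eqF //; lra.
Qed.

(** Weight of an increment of age t: the solution of w(t) = 2 w(t + 1) + C that
    vanishes for t > T, thanks to truncated subtraction. *)
Definition memory_weight (C : R) T t := C * (2 ^+ (T.+1 - t) - 1).

Lemma memory_weight_ge0 C T t : 0 <= C -> 0 <= memory_weight C T t.
Proof. by move=> C0; rewrite mulr_ge0 // subr_ge0 exprn_ege1 // ler1n. Qed.

Definition memory C T (s : nat -> R) k :=
  \sum_(0 <= j < k) memory_weight C T (k - j)%N * s j.

Lemma memory_ge0 C T s k : 0 <= C -> (forall j, 0 <= s j) -> 0 <= memory C T s k.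
Proof.
by move=> C0 s0; apply: sumr_ge0 => j _; rewrite mulr_ge0 // memory_weight_ge0.
Qed.

(** The recursion satisfied by the weights: even after multiplication by 2,
    the new memory plus the staleness charge is paid for by the old memory and a
    fixed multiple of the newest increment. *)
Lemma memory_step C T s k :
  2 * memory C T s k.+1 + C * \sum_(0 <= j < k.+1 | (k - j <= T)%N) s j =
  memory C T s k + memory_weight C T 0 * s k.
Proof.
have -> : memory C T s k + memory_weight C T 0 * s k =
    \sum_(0 <= j < k.+1) memory_weight C T (k - j)%N * s j.
  by rewrite big_nat_recr //= subnn.
rewrite /memory [in X in C * X]big_mkcond /= !mulr_sumr -big_split /= !big_nat.
apply: eq_bigr => j /andP[_ jk]; rewrite /memory_weight.
case: leqP => jT.
  have -> : (T.+1 - (k - j) = (T.+1 - (k.+1 - j)).+1)%N by lia.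
  by rewrite exprS; ring.
have -> : (T.+1 - (k - j) = 0)%N by lia.
have -> : (T.+1 - (k.+1 - j) = 0)%N by lia.
by rewrite expr0; ring.
Qed.

(** The last equality characterizes omega: it balances the surplus of the
    primal distance against the excess of the coupling term.  The hypothesis on
    theta is what makes omega at most theta. *)
Lemma rate_identity (sigma theta kappa mu : R) :
  let omega := (1 + theta * sigma * kappa) / (sigma * kappa + 1 + mu) in
  0 < sigma -> 0 <= kappa -> 0 <= mu -> (mu + 1)^-1 <= theta ->
  [/\ 0 < omega, 1 <= theta / omega, omega^-1 <= 1 + mu &
    1 + mu - omega^-1 = sigma * kappa * (theta / omega - 1)].
Proof.
move=> omega s0 k0 mu0 muth.
have mu1 : 0 < mu + 1 by lra.
have th0 : 0 < theta by apply: lt_le_trans muth; rewrite invr_gt0.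
have thmu : 1 <= theta * (mu + 1) by rewrite -ler_pdivrMr // mul1r.
have sk0 : 0 <= sigma * kappa by rewrite mulr_ge0 // ltW.
have n0 : 0 < 1 + theta * sigma * kappa.
  by rewrite -mulrA; have := mulr_ge0 (ltW th0) sk0; lra.
have d0 : 0 < sigma * kappa + 1 + mu by lra.
have omegaV : omega^-1 = (sigma * kappa + 1 + mu) / (1 + theta * sigma * kappa).
  by rewrite invf_div.
have gap : 1 + mu - omega^-1 = sigma * kappa * (theta / omega - 1).
  by rewrite omegaV; field; rewrite gt_eqF.
have rate_le : 1 <= theta / omega by rewrite omegaV mulrA ler_pdivlMr //; nra.
split=> //; first by rewrite divr_gt0.
rewrite -subr_ge0 gap mulr_ge0 // subr_ge0 //.
Qed.

(** The scalar content of one iteration.  Primes denote the values at k + 1;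
    E, W, S, D stand for |e|^2, |w|^2, |s|^2, |d|^2, B for <K e, d>, M for the
    memory, P for the staleness charge, Z for <K s, d> and Y for
    <K e', ybar - yhat>.
    In the dual hypothesis, Y + B' - theta (B + Z) is <K e', w'>. *)
Lemma lyapunov_contraction (sigma tau theta kappa mu m1 m2 c : R)
    (E W S D B M P E' W' D' B' M' Y Z : R) :
  let omega := (1 + theta * sigma * kappa) / (sigma * kappa + 1 + mu) in
  0 < sigma -> 0 < tau -> 0 <= kappa -> theta <= 1 ->
  0 <= mu -> mu <= 1 -> (mu + 1)^-1 <= theta -> mu <= m1 -> mu <= m2 ->
  c + kappa <= sigma^-1 -> 3 * kappa <= tau^-1 ->
  0 <= S -> 0 <= D -> 0 <= E' -> 0 <= W' -> 0 <= D' -> 0 <= M' ->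
  `|2 * Z| <= kappa * (S + D) -> `|2 * B'| <= kappa * (E' + D') ->
  2 * M' + P = M + c * S ->
  (1 + m1) * E' + S - sigma * P + 2 * sigma * Y <= E ->
  (1 + m2) * W' + D' - 2 * tau * (Y + B' - theta * (B + Z)) <= W ->
  sigma^-1 * E' + tau^-1 * W' - 2 * theta * B' + kappa * D' + M' <=
  omega * (sigma^-1 * E + tau^-1 * W - 2 * theta * B + kappa * D + M).
Proof.
move=> omega s0 t0 k0 th1 mu0 mu1 muth mm1 mm2 cs kt S0 D0 E0 W0 D'0 M0.
move=> hZ hB mem hE hW.
have [omega_gt0 rth r_le rid] := rate_identity s0 k0 mu0 muth.
rewrite -/omega in omega_gt0 rth r_le rid.
have th0 : 0 <= theta by apply: le_trans muth; rewrite invr_ge0; lra.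
have r_gt0 : 0 < omega^-1 by rewrite invr_gt0.
rewrite -(ler_pM2l r_gt0) mulKf ?gt_eqF //.
move: (omega^-1) omega_gt0 rth r_le rid r_gt0 => r omega_gt0 rth r_le rid r_gt0.
have a0 : 0 < sigma^-1 by rewrite invr_gt0.
have b0 : 0 < tau^-1 by rewrite invr_gt0.
have hE1 : sigma^-1 * ((1 + m1) * E' + S) - P + 2 * Y <= sigma^-1 * E.
  have := ler_wpM2l (ltW a0) hE; rewrite !mulrDr !mulrN !mulrA.
  by rewrite [sigma^-1 * 2]mulrC -[2 * sigma^-1 * sigma]mulrA mulVf ?gt_eqF //; lra.
have hW1 : tau^-1 * ((1 + m2) * W' + D') - 2 * (Y + B' - theta * (B + Z))
    <= tau^-1 * W.
  have := ler_wpM2l (ltW b0) hW; rewrite mulrBr [tau^-1 * (2 * _ * _)]mulrA.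
  by rewrite [tau^-1 * (2 * tau)]mulrCA mulVf ?gt_eqF // mulr1.
have sa : sigma * sigma^-1 = 1 by rewrite mulfV ?gt_eqF.
move: (sigma^-1) (tau^-1) a0 b0 cs kt hE1 hW1 sa => a b a0 b0 cs kt hE1 hW1 sa.
have e1 : (1 + mu) * (a * E') <= a * ((1 + m1) * E').
  by rewrite [leRHS]mulrCA ler_wpM2r ?lerD2l // mulr_ge0 // ltW.
have w1 : r * (b * W') <= b * ((1 + m2) * W').
  by rewrite [leRHS]mulrCA ler_wpM2r ?mulr_ge0 ?(ltW b0) // (le_trans r_le) ?lerD2l.
have z1 : - (kappa * (S + D)) <= 2 * theta * Z.
  have h1 : theta * `|2 * Z| <= `|2 * Z| by rewrite ler_piMl.
  have h2 := ler_wpM2l th0 (ler_norm (- (2 * Z))); rewrite normrN in h2; nra.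
(* With r = 1 / omega, the claim needs - 2 theta r B' where the hypotheses
   provide - 2 B'; [e2] pays for the E' part of the difference with the
   surplus of E', and [d1] for the D' part. *)
have b1 : - ((theta * r - 1) * (kappa * (E' + D'))) <= (theta * r - 1) * (2 * B').
  have t1 : 0 <= theta * r - 1 by lra.
  rewrite -mulrN ler_wpM2l // lerNl (le_trans (ler_norm _)) // normrN //.
have e2 : r * (a * E') + (theta * r - 1) * (kappa * E') = (1 + mu) * (a * E').
  have -> : (1 + mu) = r + sigma * kappa * (theta * r - 1) by rewrite -rid; ring.
  rewrite [RHS]mulrDl; congr (_ + _).
  by rewrite -[LHS]mul1r -sa; ring.
(* As theta r <= r <= 2, the two terms amount to at most 3 kappa D'. *)
have d1 : (theta * r - 1) * (kappa * D') + r * (kappa * D') <= b * D'.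
  have kD : 0 <= kappa * D' by rewrite mulr_ge0.
  have := ler_wpM2r D'0 kt; have : theta * r <= r by rewrite ler_piMl // ltW.
  nra.
have s1 : (c + kappa) * S <= a * S by rewrite ler_wpM2r.
have m1' : r * M' <= 2 * M' by rewrite ler_wpM2r //; lra.
lra.
Qed.

End Descent.

(** * Linear convergence *)

Section Decay.
Context {R : realType}.

Lemma geometric_decay (omega : R) (V : nat -> R) :
  0 <= omega -> (forall k, V k.+1 <= omega * V k) ->
  forall k, V k <= omega ^+ k * V 0%N.
Proof.
move=> w0 Vs; elim=> [|k IH]; first by rewrite expr0 mul1r.
by rewrite (le_trans (Vs k)) // exprS -mulrA ler_wpM2l.
Qed.

Lemma enorm_le_rate n (u : 'cV[R]_n) omega k c :
  0 <= omega -> dot u u <= omega ^+ k * c ->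
  enorm u <= Num.sqrt c * omega `^ (k%:R / 2).
Proof.
move=> w0 uc; rewrite powRrM powR_mulrn // powR12_sqrt ?exprn_ge0 //.
by rewrite mulrC -sqrtrM ?exprn_ge0 // /enorm ler_wsqrtr.
Qed.

End Decay.

Unset Implicit Arguments.
Set Strict Implicit.

Theorem theorem3p3 (R : realType) (d1 d2 N T : nat)
  (f : 'I_N -> 'cV[R]_d1 -> R) (K : 'M[R]_(d2, d1))
  (h : 'cV[R]_d2 -> \bar R)
  (L delta : 'I_N -> R) (gamma : R) (delay : nat -> 'I_N -> nat)
  (xhat : 'cV[R]_d1) (yhat : 'cV[R]_d2)
  (f_diff : forall i x, differentiable (f i) x)
  (f_convex : forall i, convex_function setT (f i))
  (f_smooth : forall i, smooth_with (L i) (f i))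
  (L_gt0 : 0 < \sum_(i < N) L i)
  (h_proper : proper_fun h) (h_closed : closed_fun h)
  (h_convex : convex_efun h)
  (delay_le : forall k i, (delay k i <= T)%N)
  (f_lower : forall i x y,
     f i x + dot (grad (f i) x) (y - x) + delta i / 2 * enorm (y - x) ^+ 2
       <= f i y)
  (delta_gt0 : 0 < \sum_(i < N) delta i)
  (gamma_gt0 : 0 < gamma) (h_strong : strongly_convex gamma h)
  (saddle : saddle_point (lagrangian (fun x => \sum_(i < N) f i x) K h)
     xhat yhat)
  (saddle_unique : forall x y,
     saddle_point (lagrangian (fun x => \sum_(i < N) f i x) K h) x y ->
     x = xhat /\ y = yhat) :
  exists sigmabar taubar : R, [/\ 0 < sigmabar, 0 < taubar &
    forall sigma tau theta : R,
      0 < sigma -> sigma <= sigmabar -> 0 < tau -> tau <= taubar ->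
      let mu := Num.min (3 * (\sum_(i < N) delta i) * sigma / 2)
                        (2 * gamma * tau) in
      (mu + 1)^-1 <= theta -> theta <= 1 ->
      let omega := (1 + theta * sigma * opnorm K)
                     / (sigma * opnorm K + 1 + mu) in
      forall (x : nat -> 'cV[R]_d1) (y : nat -> 'cV[R]_d2),
        pd_piag f K h delay sigma tau theta x y ->
        exists C : R, forall k : nat,
          enorm (x k - xhat) + enorm (y k - yhat)
            <= C * omega `^ (k%:R / 2)].
Proof.
have K0 := opnorm_ge0 K; set kappa := opnorm K in K0 *.
have C0 := delay_cost_ge0 L T delta_gt0.
set C := delay_cost L delta T in C0.
set c := memory_weight C T 0; have c0 : 0 <= c := memory_weight_ge0 T 0 C0.
have b1 : 0 < c + kappa + 1 by lra.
have b2 : 0 < 3 * kappa + 2 * gamma by lra.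
(* The 1 in sigmabar keeps |e_k|^2 with a positive coefficient below V_k;
   the 2 gamma in taubar forces mu <= 1, hence 1 / omega <= 2. *)
exists (c + kappa + 1)^-1, (3 * kappa + 2 * gamma)^-1.
split; rewrite ?invr_gt0 // => sigma tau theta s0 s1 t0 t1 mu muth th1 omega.
move=> x y xy.
have {}s1 : c + kappa + 1 <= sigma^-1.
  by rewrite -[leLHS]invrK lef_pV2 ?posrE ?invr_gt0.
have {}t1 : 3 * kappa + 2 * gamma <= tau^-1.
  by rewrite -[leLHS]invrK lef_pV2 ?posrE ?invr_gt0.
have mu0 : 0 <= mu.
  by rewrite le_min; apply/andP; split; rewrite ?mulr_ge0 // ltW.
have mu1 : mu <= 1.
  apply: (@le_trans _ _ (2 * gamma * tau)); first by rewrite ge_min lexx orbT.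
  by rewrite -ler_pdivlMr // mul1r; lra.
have [omega_gt0 _ _ _] := rate_identity s0 K0 mu0 muth.
rewrite -/omega in omega_gt0.
pose e k := x k - xhat; pose w k := y k - yhat.
pose s k := dot (x k.+1 - x k) (x k.+1 - x k).
pose d k := y k - y k.-1; pose B k := dot (K *m e k) (d k).
pose V k := sigma^-1 * dot (e k) (e k) + tau^-1 * dot (w k) (w k)
  - 2 * theta * B k + kappa * dot (d k) (d k) + memory C T s k.
have s_ge0 j : 0 <= s j by apply: dot_ge0.
have oy := saddle_subdiff h_proper saddle.
have ox v := saddle_gradient_ge0 v h_proper f_smooth saddle.
have V_step k : V k.+1 <= omega * V k.
  have [xk yk] := xy k.
  apply: (lyapunov_contraction (c := c) (S := s k)
    (P := C * \sum_(0 <= j < k.+1 | (k - j <= T)%N) s j)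
    (m1 := 3 * (\sum_i delta i) * sigma / 2) (m2 := 2 * gamma * tau)
    (Y := dot (K *m e k.+1) (y k + theta *: d k - yhat))
    (Z := dot (K *m (x k.+1 - x k)) (d k))) => //.
  - by rewrite ge_min lexx.
  - by rewrite ge_min lexx orbT.
  - by lra.
  - by lra.
  - exact: dot_ge0.
  - exact: dot_ge0.
  - exact: dot_ge0.
  - exact: dot_ge0.
  - exact: memory_ge0.
  - exact: dot_mulmx_young.
  - exact: dot_mulmx_young.
  - exact: memory_step.
  - exact: (primal_descent f_smooth f_lower delta_gt0 (delay_le k) ox s0 xk).
  - have := dual_descent h_proper h_convex h_strong t0 oy yk.
    suff -> : dot (K *m (x k.+1 - xhat)) (y k.+1 - yhat) =
        dot (K *m e k.+1) (y k + theta *: d k - yhat) + B k.+1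
        - theta * (B k + dot (K *m (x k.+1 - x k)) (d k)) by [].
    have -> : B k + dot (K *m (x k.+1 - x k)) (d k) = dot (K *m e k.+1) (d k).
      by rewrite -dotDl -mulmxDr /e addrC addrA subrK.
    rewrite -dotZr -dotNr -!dotDr; congr (dot _ _).
    by apply/colP => i; rewrite !mxE /=; ring.
have V_ge k : dot (e k) (e k) + tau^-1 * dot (w k) (w k) <= V k.
  have mem0 := memory_ge0 T k C0 s_ge0.
  have := dot_mulmx_young K (e k) (d k); rewrite -/(B k) -/kappa => young.
  have th0 : 0 <= theta by apply: le_trans muth; rewrite invr_ge0; lra.
  have : 2 * theta * B k <= kappa * (dot (e k) (e k) + dot (d k) (d k)).
    apply: le_trans young; rewrite -mulrA mulrCA.
    rewrite (le_trans (ler_wpM2l th0 (ler_norm _))) // ler_piMl //.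
  have : (kappa + 1) * dot (e k) (e k) <= sigma^-1 * dot (e k) (e k).
    by rewrite ler_wpM2r ?dot_ge0 //; lra.
  rewrite /V; lra.
have V_decay := geometric_decay (ltW omega_gt0) V_step.
exists (Num.sqrt (V 0%N) + Num.sqrt (tau * V 0%N)) => k.
have e_ge0 := dot_ge0 (e k).
have w_ge0 := mulr_ge0 (ltW t0) (dot_ge0 (w k)).
have ti0 : 0 <= tau^-1 by rewrite invr_ge0 ltW.
have tw0 := mulr_ge0 ti0 (dot_ge0 (w k)).
rewrite mulrDl lerD // enorm_le_rate ?(ltW omega_gt0) //.
  by have := V_ge k; have := V_decay k; rewrite -/(e k); lra.
rewrite -/(w k) mulrCA -ler_pdivrMl //.
by have := V_ge k; have := V_decay k; lra.
Qed.
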